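(* Let $B$ be a chord diagram with $n$ chords, viewed as a fixed-point-free involution $\alpha_B$ of $\{1,\dots,2n\}$. Put $v=2\varepsilon+N\varepsilon^2$. Then $$F_\varepsilon(\alpha_B)=\overline{Q}_{\gamma(B)}(v,N).$$ In particular, $F_\varepsilon(\alpha_B)$ is a polynomial in $v$ (with coefficients polynomials in $N$).
   Context: For a positive integer $N$, let $E_{ij}$ be the matrix units of $\mathfrak{gl}(N)$. For $\alpha\in\mathbb S_m$ set $w_{\mathfrak{gl}(N)}(\alpha)=\sum_{i_1,\dots,i_m=1}^N E_{i_1i_{\alpha(1)}}\cdots E_{i_mi_{\alpha(m)}}\in U\mathfrak{gl}(N)$, and $C_k^{(N)}=w_{\mathfrak{gl}(N)}((1,2,\dots,k))$. The universal $\mathfrak{gl}$-weight system $w_{\mathfrak{gl}}(\alpha)$ is the (unique; existence by a theorem of Z. Yang) polynomial in $\mathbb C[N,C_1,C_2,\dots]$ such that for every positive integer $N$, substituting this integer for $N$ and $C_k^{(N)}$ for $C_k$ yields $w_{\mathfrak{gl}(N)}(\alpha)$. Define $F_\varepsilon(\alpha)\in\mathbb C[N,\varepsilon]$ by substituting $C_k:=\frac1N\big((N+\varepsilon)^k-(1-N^2)\varepsilon^k\big)$, $k\ge1$, into $w_{\mathfrak{gl}}(\alpha)$. A chord diagram with $n$ chords is $2n$ points on an oriented circle split into $n$ pairs (chords); numbering the points $1,\dots,2n$ along the circle gives a fixed-point-free involution. The intersection graph $\gamma(B)$ has the chords as vertices, two joined by an edge iff their endpoints alternate along the circle. For a simple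 graph $G$ and $U\subset V(G)$, $A_U$ is the adjacency matrix of the induced subgraph $G|_U$ over $\mathbb F_2$ (the empty matrix has corank $0$). The refined skew-characteristic polynomial is $\overline{Q}_G(u,w)=\sum_{U\subset V(G)}u^{|V(G)|-|U|}w^{\operatorname{corank}A_U}$. *)

(* Defs.v *)
From HB Require Import structures.
From mathcomp Require Import all_boot all_order all_algebra perm.
From mathcomp Require Import ring_quotient generic_quotient.
From mathcomp Require Import boolp reals complex finmap monalg.

Set Implicit Arguments.
Unset Strict Implicit.
Unset Printing Implicit Defensive.

Import GRing.Theory.

Local Open Scope ring_scope.
Local Open Scope quotient_scope.

(* U gl(N) over K: the free associative algebra on the symbols (i, j),        *)
(* standing for E_ij, modulo the two-sided ideal generated by                 *)
(*   E_ij E_kl - E_kl E_ij - (delta_jk E_il - delta_li E_kj).                 *)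
Section UniversalEnvelopingAlgebra.
Variables (K : fieldType) (N : nat).

Definition free_gl := {malg K[{fmonom ('I_N * 'I_N)%type}]}.
HB.instance Definition _ := GRing.Lalgebra.on free_gl.

Definition free_E (i j : 'I_N) : free_gl := mkmalgU (fmu (i, j)) 1.

Definition gl_rel (i j k l : 'I_N) : free_gl :=
  free_E i j * free_E k l - free_E k l * free_E i j
  - (free_E i l *+ (j == k) - free_E k j *+ (l == i)).

Inductive gl_ideal : free_gl -> Prop :=
| gl_ideal_rel i j k l : gl_ideal (gl_rel i j k l)
| gl_ideal0 : gl_ideal 0
| gl_idealD x y : gl_ideal x -> gl_ideal y -> gl_ideal (x + y)
| gl_idealMl a x : gl_ideal x -> gl_ideal (a * x)
| gl_idealMr a x : gl_ideal x -> gl_ideal (x * a).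

Definition gl_idealb : {pred free_gl} := fun x => `[< gl_ideal x >].

Lemma gl_idealP x : reflect (gl_ideal x) (x \in gl_idealb).
Proof. exact: asboolP. Qed.

Fact gl_idealb_zmod_closed : zmod_closed gl_idealb.
Proof.
split=> [|x y /gl_idealP Jx /gl_idealP Jy]; apply/gl_idealP.
  exact: gl_ideal0.
by apply: gl_idealD => //; rewrite -mulN1r; apply: gl_idealMl.
Qed.
HB.instance Definition _ := GRing.isZmodClosed.Build free_gl gl_idealb
  gl_idealb_zmod_closed.

Definition Ugl := Quotient.quot gl_idealb.
HB.instance Definition _ := Choice.on Ugl.
HB.instance Definition _ := GRing.Zmodule.on Ugl.
HB.instance Definition _ := EqQuotient.on Ugl.

Definition Ugl_pi (x : free_gl) : Ugl := \pi_Ugl x.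

Lemma Ugl_piP x y : Ugl_pi x = Ugl_pi y <-> gl_ideal (x - y).
Proof.
split=> [/eqP|/gl_idealP J]; last by apply/eqP; rewrite -Quotient.idealrBE.
by rewrite -Quotient.idealrBE => /gl_idealP.
Qed.

Lemma Ugl_reprK (x : Ugl) : Ugl_pi (repr x) = x.
Proof. exact: reprK. Qed.

Lemma Ugl_piD x y : Ugl_pi (x + y) = Ugl_pi x + Ugl_pi y.
Proof. exact: Quotient.pi_add. Qed.

Definition Ugl_one : Ugl := Ugl_pi 1.
Definition Ugl_mul (x y : Ugl) : Ugl := Ugl_pi (repr x * repr y).
Definition Ugl_scale (c : K) (x : Ugl) : Ugl := Ugl_pi (c *: repr x).

Lemma repr_pi x : gl_ideal (repr (Ugl_pi x) - x).
Proof. by apply/Ugl_piP; rewrite Ugl_reprK. Qed.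

Lemma Ugl_mulE x y : Ugl_mul (Ugl_pi x) (Ugl_pi y) = Ugl_pi (x * y).
Proof.
apply/Ugl_piP; set x' := repr _; set y' := repr _.
have -> : x' * y' - x * y = (x' - x) * y' + x * (y' - y).
  by rewrite mulrBl mulrBr addrA subrK.
by apply: gl_idealD; [apply: gl_idealMr | apply: gl_idealMl]; apply: repr_pi.
Qed.

Lemma Ugl_scaleE c x : Ugl_scale c (Ugl_pi x) = Ugl_pi (c *: x).
Proof.
apply/Ugl_piP; rewrite -scalerBr -[X in c *: X]mul1r scalerAl.
by apply: gl_idealMl; apply: repr_pi.
Qed.

Fact Ugl_mulA : associative Ugl_mul.
Proof.
move=> x y z; rewrite -(Ugl_reprK x) -(Ugl_reprK y) -(Ugl_reprK z).
by rewrite !Ugl_mulE mulrA.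
Qed.

Fact Ugl_mul1 : left_id Ugl_one Ugl_mul.
Proof. by move=> x; rewrite -(Ugl_reprK x) Ugl_mulE mul1r. Qed.

Fact Ugl_mulr1 : right_id Ugl_one Ugl_mul.
Proof. by move=> x; rewrite -(Ugl_reprK x) Ugl_mulE mulr1. Qed.

Fact Ugl_mulDl : left_distributive Ugl_mul +%R.
Proof.
move=> x y z; rewrite -(Ugl_reprK x) -(Ugl_reprK y) -(Ugl_reprK z).
by rewrite -Ugl_piD !Ugl_mulE mulrDl Ugl_piD.
Qed.

Fact Ugl_mulDr : right_distributive Ugl_mul +%R.
Proof.
move=> x y z; rewrite -(Ugl_reprK x) -(Ugl_reprK y) -(Ugl_reprK z).
by rewrite -Ugl_piD !Ugl_mulE mulrDr Ugl_piD.
Qed.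

Lemma gl_ideal_augmentation x : gl_ideal x -> mcoeff mone x = 0.
Proof.
have E0 i j : mcoeff mone (free_E i j) = 0.
  by rewrite mcoeffU; case: eqP => // /(congr1 (@fmonom_val _));
    rewrite fmU fm1.
have M (a b : free_gl) : mcoeff mone (a * b) = mcoeff mone a * mcoeff mone b.
  exact: (mcoeff1g_is_multiplicative _ _).1.
elim=> {x} [i j k l||x y _ x0 _ y0|a x _ x0|a x _ x0].
- by rewrite !(mcoeffB, mcoeffMn, M) !E0 !mulr0 !mul0rn !subrr.
- exact: mcoeff0.
- by rewrite mcoeffD x0 y0 addr0.
- by rewrite M x0 mulr0.
- by rewrite M x0 mul0r.
Qed.

Fact Ugl_one_neq0 : Ugl_one != 0.
Proof.
apply/eqP => /= e; have : Ugl_pi 1 = Ugl_pi 0.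
  by rewrite [LHS]e; apply: (addrI (Ugl_pi 0)); rewrite -Ugl_piD !addr0.
move/Ugl_piP/gl_ideal_augmentation/eqP.
by rewrite subr0 mcoeff1 eqxx oner_eq0.
Qed.

HB.instance Definition _ := GRing.Zmodule_isNzRing.Build Ugl
  Ugl_mulA Ugl_mul1 Ugl_mulr1 Ugl_mulDl Ugl_mulDr Ugl_one_neq0.

Fact Ugl_scaleA a b x : Ugl_scale a (Ugl_scale b x) = Ugl_scale (a * b) x.
Proof. by rewrite -(Ugl_reprK x) !Ugl_scaleE scalerA. Qed.

Fact Ugl_scale1 : left_id 1 Ugl_scale.
Proof. by move=> x; rewrite -(Ugl_reprK x) !Ugl_scaleE scale1r. Qed.

Fact Ugl_scaleDr : right_distributive Ugl_scale +%R.
Proof.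
move=> a x y; rewrite -(Ugl_reprK x) -(Ugl_reprK y).
by rewrite -Ugl_piD !Ugl_scaleE scalerDr Ugl_piD.
Qed.

Fact Ugl_scaleDl x : {morph Ugl_scale^~ x : a b / a + b}.
Proof. by move=> a b; rewrite -(Ugl_reprK x) !Ugl_scaleE scalerDl Ugl_piD. Qed.

HB.instance Definition _ := GRing.Zmodule_isLmodule.Build K Ugl
  Ugl_scaleA Ugl_scale1 Ugl_scaleDr Ugl_scaleDl.

Fact Ugl_scaleAl (a : K) (x y : Ugl) : a *: (x * y) = (a *: x) * y.
Proof.
rewrite -(Ugl_reprK x) -(Ugl_reprK y).
by rewrite /GRing.scale /GRing.mul /= !(Ugl_mulE, Ugl_scaleE) scalerAl.
Qed.

HB.instance Definition _ := GRing.Lmodule_isLalgebra.Build K Ugl Ugl_scaleAl.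

Definition Ugl_E (i j : 'I_N) : Ugl := Ugl_pi (free_E i j).

(* The factors are multiplied in increasing order of k.                       *)
Definition w_glN m (alpha : 'S_m) : Ugl :=
  \sum_(i : {ffun 'I_m -> 'I_N}) \prod_(k < m) Ugl_E (i k) (i (alpha k)).

Definition casimir (k : nat) : Ugl := w_glN (perm (@ordS_inj k)).

End UniversalEnvelopingAlgebra.

(* K[N, C_1, C_2, ...]: the variable of index 0 is N, that of index k > 0 is  *)
(* C_k.                                                                       *)
Notation casimir_poly K := {malg K[{cmonom nat}]}.

Section UniversalWeightSystem.
Variable K : fieldType.

(* The substitution N := xN, C_k := xC k in a ring A, coefficients being      *)
(* mapped by iota. It is only used with pairwise commuting values, so the     *)
(* order of the product is immaterial.                                        *)
Definition casimir_subst (A : nzRingType) (iota : K -> A) (xN : A)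
    (xC : nat -> A) (P : casimir_poly K) : A :=
  mmap iota
    (fun m : {cmonom nat} =>
       \prod_(k <- finsupp m) (if k is 0 then xN else xC k) ^+ m k)
    P.

Definition is_w_gl m (alpha : 'S_m) (P : casimir_poly K) : Prop :=
  forall N : nat, (0 < N)%N ->
    casimir_subst (in_alg (Ugl K N)) N%:R (@casimir K N) P = w_glN K N alpha.

(* K[N, eps] is {poly {poly K}}: N is the outer variable, eps the inner one.  *)
Definition varN : {poly {poly K}} := 'X.
Definition vareps : {poly {poly K}} := 'X%:P.

(* The division by N is exact, see casimir_valueE.                            *)
Definition casimir_value (k : nat) : {poly {poly K}} :=
  ((varN + vareps) ^+ k - (1 - varN ^+ 2) * vareps ^+ k) %/ varN.

Lemma casimir_valueE k :
  varN * casimir_value k =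
  (varN + vareps) ^+ k - (1 - varN ^+ 2) * vareps ^+ k.
Proof.
rewrite /casimir_value; set p := (X in X %/ _).
have Xp : dvdp 'X p.
  rewrite -['X]subr0 -polyC0 Pdiv.CommonIdomain.dvdp_XsubCl rootE /p /varN /vareps.
  by rewrite !hornerE /= expr0n /= subr0 mul1r subrr.
move: Xp; rewrite (Pdiv.IdomainMonic.dvdp_eq (monicX _)) => /eqP e.
by rewrite mulrC; apply: esym e.
Qed.

Definition F_eps (P : casimir_poly K) : {poly {poly K}} :=
  casimir_subst (fun c : K => c%:P%:P) varN casimir_value P.

Definition varv : {poly {poly K}} := 2 * vareps + varN * vareps ^+ 2.

End UniversalWeightSystem.

Record sgraph := SGraph {
  svertex :> finType;
  sedge : rel svertex;
  sedge_sym : symmetric sedge;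
  sedge_irrefl : irreflexive sedge
}.

Definition adjmx (G : sgraph) (U : {set G}) : 'M['F_2]_#|U| :=
  \matrix_(i, j) (sedge (enum_val i) (enum_val j))%:R.

Definition corank (F : fieldType) n (A : 'M[F]_n) : nat := (n - \rank A)%N.

Definition refined_skew_char (A : comNzRingType) (G : sgraph) (u w : A) : A :=
  \sum_(U : {set G}) u ^+ (#|G| - #|U|) * w ^+ corank (adjmx U).

Record chord_diagram (n : nat) := ChordDiagram {
  cd_perm :> 'S_(n.*2);
  cd_involutive : involutive cd_perm;
  cd_fixfree : forall i, cd_perm i != i
}.

Section IntersectionGraph.
Variables (n : nat) (B : chord_diagram n).

Definition chords : {set {set 'I_(n.*2)}} :=
  [set [set i; B i] | i in 'I_(n.*2)].

Definition chord := {c : {set 'I_(n.*2)} | c \in chords}.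
HB.instance Definition _ := Finite.on chord.

Definition alternate (c d : chord) : bool :=
  [exists a in val c, exists b in val c, exists x in val d, exists y in val d,
     ((a < x) && (x < b) && (b < y)) || ((x < a) && (a < y) && (y < b))]%N.

Fact alternate_sym : symmetric alternate.
Proof.
suff H c d : alternate c d -> alternate d c by move=> c d; apply/idP/idP => /H.
case/exists_inP=> a ac /exists_inP[b bc] /exists_inP[x xd] /exists_inP[y yd] h.
apply/exists_inP; exists x => //; apply/exists_inP; exists y => //.
apply/exists_inP; exists a => //; apply/exists_inP; exists b => //.
by rewrite orbC.
Qed.

Fact alternate_irrefl : irreflexive alternate.
Proof.
move=> [c cc]; apply/negbTE/negP; rewrite /alternate /=.
have /imsetP[i _ ci] := cc.
case/exists_inP=> a /= ac /exists_inP[b /= bc] /exists_inP[x /= xc].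
case/exists_inP=> y /= yc; move: ac bc xc yc; rewrite {cc}ci.
rewrite !in_set2.
by do 4! [case/orP=> /eqP ->]; rewrite ?ltnn ?andbF //=; case: ltngtP.
Qed.

Definition intersection_graph : sgraph := SGraph alternate_sym alternate_irrefl.

End IntersectionGraph.

(* Main.v *)
(** Let [gl(N)] act on [K[eps]^N] by [E_ij |-> e_ij + eps delta_ij]. The block
matrix of the [e_ij] satisfies [P^2 = N P], so [C_k] acts by the scalar
[((N + eps)^k - (1 - N^2) eps^k) / N] and [F_eps(alpha)] at an integer [N] is the
scalar by which [w_gl(N)(alpha)] acts.

Taking the trace turns the sum into one over colourings [f] of the arcs of the
circle. Summing over the two indices of a chord with endpoints [p], [q] leaves
either the condition of a ribbon glued along the chord, [f(q+) = f(p-)] and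
[f(p+) = f(q-)], or [v = 2 eps + N eps^2] times the condition that the chord is
absent. Expanding over the set [U] of glued chords, the colourings number
[N^(faces of U)].

The number of faces is [corank A_U + 1]: it suffices to count colourings by
[F_2], and such a colouring is given by its value on one arc and by its jumps
[x_c] across the chords of [U], subject to [A_U x = 0]. *)

Require Import Defs.
From HB Require Import structures.
From mathcomp Require Import all_boot all_order all_algebra all_fingroup.
From mathcomp Require Import mxabelem reals complex finmap monalg.
From mathcomp Require Import zify ring.

Set Implicit Arguments.
Unset Strict Implicit.
Unset Printing Implicit Defensive.

Import GRing.Theory.

Local Open Scope ring_scope.

(** * Traces of products as sums over closed walks *)

Definition ffcons (T : Type) m (x : T) (f : {ffun 'I_m -> T}) :
    {ffun 'I_m.+1 -> T} :=
  [ffun i => if unlift ord0 i is Some j then f j else x].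

(** The walk [f] continued by the end vertex [b]: position [m] and all later ones read [b]. *)
Definition ffnth (T : Type) m (b : T) (f : {ffun 'I_m -> T}) (k : nat) : T :=
  if insub k is Some j then f j else b.

Lemma big_ffcons (R : nmodType) (T : finType) m (F : {ffun 'I_m.+1 -> T} -> R) :
  \sum_f F f = \sum_x \sum_(f : {ffun 'I_m -> T}) F (ffcons x f).
Proof.
rewrite pair_bigA (reindex (fun p : T * {ffun 'I_m -> T} => ffcons p.1 p.2)) //.
exists (fun f : {ffun 'I_m.+1 -> T} => (f ord0, [ffun j => f (lift ord0 j)])).
  case=> x f _ /=; congr (_, _); first by rewrite ffunE unlift_none.
  by apply/ffunP=> j; rewrite !ffunE liftK.
move=> f _; apply/ffunP=> i; rewrite ffunE /=.
by case: unliftP => [j|] ->; rewrite ?ffunE.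
Qed.

Lemma ffcons0 (T : Type) m (x : T) (f : {ffun 'I_m -> T}) : ffcons x f ord0 = x.
Proof. by rewrite ffunE unlift_none. Qed.

Lemma ffconsS (T : Type) m (x : T) (f : {ffun 'I_m -> T}) j :
  ffcons x f (lift ord0 j) = f j.
Proof. by rewrite ffunE liftK. Qed.

Lemma ffnth_ord (T : Type) m (b : T) (f : {ffun 'I_m -> T}) (k : 'I_m) :
  ffnth b f k = f k.
Proof. by rewrite /ffnth valK. Qed.

Lemma ffnth_default (T : Type) m (b : T) (f : {ffun 'I_m -> T}) :
  ffnth b f m = b.
Proof. by rewrite /ffnth insubN // ltnn. Qed.

Lemma ffnth_consS (T : Type) m (b x : T) (f : {ffun 'I_m -> T}) k :
  ffnth b (ffcons x f) k.+1 = ffnth b f k.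
Proof.
rewrite /ffnth; case: (ltnP k m) => km; last by rewrite !insubN // -leqNgt.
rewrite (insubT (fun i => i < m.+1)%N (km : (k.+1 < m.+1)%N)).
rewrite (insubT (fun i => i < m)%N km).
have -> : Sub k.+1 (km : (k.+1 < m.+1)%N) = lift ord0 (Ordinal km).
  exact: val_inj.
exact: ffconsS.
Qed.

(** Walks from [a] to [b], by induction on the length after splitting off the first step. The
    factors keep their order, so that [R] may be noncommutative; this is used for block matrices. *)
Lemma prod_mx_entry (R : nzRingType) N m (A : 'I_m.+1 -> 'M[R]_N.+1) a b :
  (\prod_k A k) a b =
  \sum_(f : {ffun 'I_m.+1 -> 'I_N.+1} | f ord0 == a)
    \prod_k A k (f k) (ffnth b f k.+1).
Proof.
rewrite [RHS]big_mkcond big_ffcons (bigD1 a) //= [X in _ = _ + X]big1 ?addr0.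
  elim: m => [|m IHm] in A a *.
    have f0 : {ffun 'I_0 -> 'I_N.+1} by apply: finfun => -[].
    rewrite big_ord1 (bigD1 f0) //= [X in _ + X]big1 ?addr0.
      by rewrite ffcons0 eqxx big_ord1 ffcons0 (ffnth_consS b a f0) ffnth_default.
    by move=> f /eqP[]; apply/ffunP => -[].
  rewrite big_ord_recl mxE [RHS]big_ffcons; apply: eq_bigr => c _.
  rewrite IHm big_distrr; apply: eq_bigr => f _ /=.
  rewrite !ffcons0 !eqxx [in RHS]big_ord_recl ffcons0.
  congr (_ * _).
    by rewrite ffnth_consS (ffnth_ord b (ffcons c f) ord0) ffcons0.
  by apply: eq_bigr => k _; rewrite ffconsS [in RHS]ffnth_consS.
by move=> x ne; rewrite big1 // => f _; rewrite ffcons0 (negPf ne).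
Qed.

Lemma mxtrace_prod (R : nzRingType) N m (A : 'I_m.+1 -> 'M[R]_N.+1) :
  \tr (\prod_k A k) =
  \sum_(f : {ffun 'I_m.+1 -> 'I_N.+1}) \prod_k A k (f k) (f (ordS k)).
Proof.
rewrite /mxtrace.
under [LHS]eq_bigr => a _ do rewrite prod_mx_entry big_mkcond /=.
rewrite exchange_big; apply: eq_bigr => f _ /=.
rewrite (bigD1 (f ord0)) //= eqxx [X in _ + X]big1 ?addr0; last first.
  by move=> a /negPf ne; rewrite eq_sym ne.
apply: eq_bigr => k _; congr (A _ _ _).
(* Only at the last position does the default value of [ffnth] intervene, and there [ordS] wraps
   around to [ord0]: the walk closes up. *)
have [km|mk] := ltnP k m.
  by rewrite -(ffnth_ord (f ord0) f (ordS k)) /= modn_small.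
have kE : k = m :> nat by apply/eqP; rewrite eqn_leq mk -ltnS ltn_ord.
by rewrite kE ffnth_default; congr (f _); apply: val_inj; rewrite /= kE modnn.
Qed.

Lemma mxtrace_prod_gt0 (R : nzRingType) N m (A : 'I_m -> 'M[R]_N.+1) :
  (0 < m)%N ->
  \tr (\prod_k A k) =
  \sum_(f : {ffun 'I_m -> 'I_N.+1}) \prod_k A k (f k) (f (ordS k)).
Proof. by case: m A => // m A _; apply: mxtrace_prod. Qed.

(** * Counting lemmas *)

(** An invariant function is constant on each orbit, hence the pullback of a unique function on the
    set [O] of orbits. *)
Lemma card_invariant_ffun (T A : finType) (s : {perm T}) :
  #|[set f : {ffun T -> A} | [forall x, f (s x) == f x]]| =
  (#|A| ^ #|porbits s|)%N.
Proof.
pose O := {c : {set T} | c \in porbits s}.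
have sub x : porbit s x \in porbits s by apply: imset_f.
pose cl x : O := Sub (porbit s x) (sub x).
pose ext (g : {ffun O -> A}) : {ffun T -> A} := [ffun x => g (cl x)].
have ext_inj : injective ext.
  move=> g h /ffunP e; apply/ffunP => -[c cO].
  have /imsetP[x _ cx] := cO; have := e x; rewrite !ffunE.
  by have -> : cl x = exist _ c cO by apply: val_inj.
transitivity #|ext @: [set: {ffun O -> A}]|; last first.
  rewrite card_imset // cardsT card_ffun card_sig.
  by congr (_ ^ _)%N; apply: eq_card.
have repP (c : O) : exists x, porbit s x == val c.
  by case: c => c /= /imsetP[x _ ->]; exists x.
apply: eq_card => f; rewrite inE; apply/forallP/imsetP => [inv|[g _ ->] x].
  exists [ffun c : O => f (xchoose (repP c))]; first by rewrite inE.
  apply/ffunP => x; rewrite !ffunE; have := xchooseP (repP (cl x)).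
  rewrite /= eq_porbit_mem; case/porbitP=> i ->.
  elim: i => [|i IHi]; first by rewrite expg0 perm1.
  by rewrite expgSr permM (eqP (inv _)).
rewrite !ffunE; apply/eqP; congr (g _); apply: val_inj => /=.
by apply/eqP; rewrite eq_porbit_mem -[X in X \in _]/((s ^+ 1)%g x) mem_porbit.
Qed.

Section AdjacencyKernel.
Variables (G : sgraph) (U : {set G}).

(** A vector supported on [U] is determined by its restriction to [U]. As the adjacency matrix is
    symmetric, the equations place this restriction in the row kernel, whose dimension is the
    corank. *)
Lemma card_adj_kernel :
  #|[set x : {ffun G -> 'F_2} |
      [forall c, if c \in U then \sum_d x d * (sedge c d)%:R == 0
                 else x c == 0]]| = (2 ^ corank (adjmx U))%N.
Proof.
have -> : corank (adjmx U) = \rank (kermx (adjmx U)) by rewrite mxrank_ker.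
transitivity #|rowg (kermx (adjmx U))|; last by rewrite card_rowg card_Fp.
pose ext (v : 'rV['F_2]_#|U|) : {ffun G -> 'F_2} :=
  [ffun c => \sum_i v 0 i * (enum_val i == c)%:R].
have extE v i : ext v (enum_val i) = v 0 i.
  rewrite ffunE (bigD1 i) //= eqxx mulr1 big1 ?addr0 // => j ji.
  by rewrite (inj_eq enum_val_inj) (negPf ji) mulr0.
have ext0 v c : c \notin U -> ext v c = 0.
  move=> cU; rewrite ffunE big1 // => i _.
  by case: eqP => [e|]; rewrite ?mulr0 //; rewrite -e enum_valP in cU.
have ext_inj : injective ext.
  by move=> v w e; apply/rowP=> i; rewrite -!extE e.
have ext_sum v j :
    \sum_d ext v d * (sedge (enum_val j) d)%:R = (v *m adjmx U) 0 j.
  rewrite mxE (bigID (mem U)) /= [X in _ + X]big1 ?addr0; last first.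
    by move=> d dU; rewrite ext0 // mul0r.
  rewrite [LHS](big_enum_val (A := mem U)).
  by apply: eq_bigr => i _; rewrite extE mxE sedge_sym.
rewrite -(card_imset _ ext_inj); apply: eq_card => x; rewrite inE.
apply/forallP/imsetP => [Hx|[v]].
  pose v : 'rV['F_2]_#|U| := \row_i x (enum_val i).
  have xv : x = ext v.
    apply/ffunP=> c; have [cU|cU] := boolP (c \in U).
      by rewrite -(enum_rankK_in cU cU) extE mxE.
    by have := Hx c; rewrite (negPf cU) ext0 // => /eqP.
  exists v => //; rewrite inE; apply/sub_kermxP/rowP => j.
  rewrite -ext_sum -xv mxE; have := Hx (enum_val j).
  by rewrite enum_valP => /eqP.
rewrite inE => /sub_kermxP kv -> c.
have [cU|cU] := boolP (c \in U); last by rewrite ext0.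
by rewrite -(enum_rankK_in cU cU) ext_sum kv mxE.
Qed.
End AdjacencyKernel.

(** * Chords and faces *)

Section Chords.
Variables (n : nat) (B : chord_diagram n).
Local Notation point := 'I_(n.*2).
Implicit Types (k l : point) (c d : chord B).

Let BK : involutive B := @cd_involutive n B.

Fact mem_chords k : [set k; B k] \in chords B.
Proof. by apply/imsetP; exists k. Qed.

Definition chord_of k : chord B := exist _ [set k; B k] (mem_chords k).

Fact chord_endpoint c : exists k, val c == [set k; B k].
Proof. by case: c => c /= /imsetP[k _ ->]; exists k. Qed.

(** An arbitrary choice of one endpoint; the other one is [B (endpoint c)]. *)
Definition endpoint c : point := xchoose (chord_endpoint c).

Lemma val_chord c : val c = [set endpoint c; B (endpoint c)].
Proof. exact/eqP/(xchooseP (chord_endpoint c)). Qed.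

Lemma endpointK : cancel endpoint chord_of.
Proof. by move=> c; apply: val_inj; rewrite [RHS]val_chord. Qed.

Lemma chord_of_partner k : chord_of (B k) = chord_of k.
Proof. by apply: val_inj; rewrite /= BK setUC. Qed.

Lemma endpoint_chord_of k :
  endpoint (chord_of k) = k \/ endpoint (chord_of k) = B k.
Proof.
have : endpoint (chord_of k) \in val (chord_of k).
  by rewrite val_chord in_set2 eqxx.
by rewrite /= in_set2 => /orP[] /eqP; [left | right].
Qed.

Definition chord_pt (p : chord B * bool) : point :=
  if p.2 then B (endpoint p.1) else endpoint p.1.

Definition pt_chord k : chord B * bool :=
  (chord_of k, k != endpoint (chord_of k)).

Lemma chord_ptK : cancel chord_pt pt_chord.
Proof.
case=> c [] /=; rewrite /pt_chord /chord_pt /= ?chord_of_partner endpointK.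
  by rewrite cd_fixfree.
by rewrite eqxx.
Qed.

Lemma pt_chordK : cancel pt_chord chord_pt.
Proof.
move=> k; rewrite /chord_pt /=; case: eqP => [//|ne] /=.
by case: (endpoint_chord_of k) ne => -> // _; rewrite BK.
Qed.

Lemma big_chords (R : Type) (idx : R) (op : Monoid.com_law idx) (F : point -> R) :
  \big[op/idx]_k F k =
  \big[op/idx]_c op (F (endpoint c)) (F (B (endpoint c))).
Proof.
rewrite (reindex chord_pt); last first.
  by exists pt_chord => x _; [apply: chord_ptK | apply: pt_chordK].
rewrite -(pair_bigA op (fun c b => F (chord_pt (c, b)))) /=.
by apply: eq_bigr => c _; rewrite big_bool Monoid.mulmC.
Qed.

(** Colouring the points amounts to choosing a pair of colours for each chord independently, so the
    sum distributes over the product. *)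
Lemma big_ffun_chords (R : comNzRingType) (A : finType)
    (H : chord B -> A -> A -> R) :
  \sum_(i : {ffun point -> A})
     \prod_c H c (i (endpoint c)) (i (B (endpoint c))) =
  \prod_c \sum_a \sum_b H c a b.
Proof.
under [RHS]eq_bigr => c _ do rewrite pair_bigA.
rewrite bigA_distr_bigA /=.
rewrite (reindex (fun g : {ffun chord B -> A * A} => [ffun k =>
  if k == endpoint (chord_of k) then (g (chord_of k)).1
  else (g (chord_of k)).2])); last first.
  exists (fun i : {ffun point -> A} =>
            [ffun c => (i (endpoint c), i (B (endpoint c)))]).
    move=> g _; apply/ffunP=> c; rewrite !ffunE chord_of_partner endpointK eqxx.
    by rewrite (negPf (cd_fixfree _ _)); case: (g c).
  move=> i _; apply/ffunP=> k; rewrite !ffunE.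
  case: eqP => [<- //|ne] /=.
  by case: (endpoint_chord_of k) ne => -> // _; rewrite BK.
apply: eq_bigr => g _; apply: eq_bigr => c _.
by rewrite !ffunE chord_of_partner endpointK eqxx (negPf (cd_fixfree _ _)).
Qed.

Definition partner_in (U : {set chord B}) k := if chord_of k \in U then B k else k.

Lemma partner_inK U : involutive (partner_in U).
Proof.
rewrite /partner_in => k; have [kU|kU] := boolP (chord_of k \in U).
  by rewrite chord_of_partner kU BK.
by rewrite (negPf kU).
Qed.

(* The arc between [k - 1] and [k] is denoted by [k]; walking along the boundary
   of the ribbon graph of [U] leads from the arc [k] to the arc that follows the
   partner of [k]. *)
Definition face_step U : {perm point} :=
  perm (inj_comp (@ordS_inj _) (inv_inj (partner_inK U))).

Lemma face_stepE U k : face_step U k = ordS (partner_in U k).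
Proof. by rewrite permE. Qed.

Lemma exists_in_set2 (T : finType) (a b : T) (P : pred T) :
  [exists x in [set a; b], P x] = P a || P b.
Proof.
apply/exists_inP/orP => [[x]|[Pa|Pb]].
- by rewrite in_set2 => /orP[] /eqP ->; [left | right].
- by exists a; rewrite // in_set2 eqxx.
- by exists b; rewrite // in_set2 eqxx orbT.
Qed.

(** Modulo 2 the sum counts the endpoints of [d] that separate [k] from [B k], and distinct chords
    alternate when this number is odd. For [d] the chord of [k] itself the strict inequalities
    contribute exactly 1, whence the correction term. *)
Lemma alternate_parity k d :
  odd ((endpoint d < k) + (B (endpoint d) < k) +
       ((endpoint d < B k) + (B (endpoint d) < B k))) =
  alternate (chord_of k) d (+) (d == chord_of k).
Proof.
case: eqP => [->|/eqP dk].
  rewrite alternate_irrefl /=.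
  have := cd_fixfree B k; rewrite -val_eqE /=.
  by case: (endpoint_chord_of k) => ->; rewrite ?BK !ltnn; case: ltngtP.
rewrite addbF /alternate (val_chord d) /= !exists_in_set2.
set p := endpoint d in dk *.
have pk : p != k by apply: contraNneq dk => <-; rewrite endpointK.
have pBk : p != B k.
  by apply: contraNneq dk => pE; rewrite -[d]endpointK -/p pE chord_of_partner.
have qk : B p != k by apply: contraNneq pBk => <-; rewrite BK.
have qBk : B p != B k by rewrite (inj_eq perm_inj).
have kk := cd_fixfree B k; have pp := cd_fixfree B p.
move: pk pBk qk qBk kk pp; rewrite -!val_eqE /=.
move: (val p) (val (B p)) (val k) (val (B k)) => x y z t.
(* The four endpoints are distinct naturals: every relative order is checked, and the inconsistent
   ones are refuted arithmetically. *)
case: (ltngtP x z) => // ? _; case: (ltngtP x t) => // ? _;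
case: (ltngtP y z) => // ? _; case: (ltngtP y t) => // ? _;
case: (ltngtP t z) => // ? _; case: (ltngtP y x) => //= ? _;
by [|exfalso; lia].
Qed.
End Chords.

(** * Faces and the kernel of the adjacency matrix over the field with two elements *)

Lemma addrr_F2 (x : 'F_2) : x + x = 0.
Proof. exact/addrr_pchar2/pchar_Fp. Qed.

Lemma natr_F2 m : m%:R = (odd m)%:R :> 'F_2.
Proof.
elim: m => // m IHm; rewrite -natr1 IHm /=.
by case: (odd m); apply: val_inj.
Qed.

Lemma addr_eq_F2 (x y : 'F_2) : (x == y) = (x + y == 0).
Proof. by rewrite -subr_eq0 (oppr_pchar2 (pchar_Fp _)). Qed.

Section FaceCount.
Variables (n : nat) (B : chord_diagram n).
Local Notation point := 'I_(n.*2).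
Implicit Types (k : point) (x : {ffun chord B -> 'F_2}) (U : {set chord B}).

(* The colouring of the arcs that has value [t] on the arc [0] and jumps by
   [x c] at both endpoints of the chord [c]. *)
Definition potential (t : 'F_2) x : {ffun point -> 'F_2} :=
  [ffun k : point => t + \sum_(r : point | (r < k)%N) x (chord_of B r)].

Lemma sum_before x k :
  \sum_(r : point | (r < k)%N) x (chord_of B r) =
  \sum_d x d * ((endpoint d < k) + (B (endpoint d) < k))%N%:R.
Proof.
rewrite big_mkcond (big_chords B) /=; apply: eq_bigr => d _.
rewrite chord_of_partner endpointK natrD mulrDr.
by do 2!case: ifP => _; rewrite ?mulr1 ?mulr0.
Qed.

Lemma potential_step t x k :
  potential t x (ordS k) = potential t x k + x (chord_of B k).
Proof.
have sumS : \sum_(r : point | (r < k.+1)%N) x (chord_of B r) =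
            \sum_(r : point | (r < k)%N) x (chord_of B r) + x (chord_of B k).
  rewrite (bigD1 k) //= addrC; congr (_ + _); apply: eq_bigl => r.
  by rewrite ltnS [in RHS]ltn_neqAle andbC -val_eqE.
rewrite !ffunE -addrA -sumS; congr (_ + _).
have [km|] := ltnP k.+1 n.*2; first by rewrite /= modn_small.
(* After the last point comes the arc 0. The colouring closes up because each chord contributes its
   jump twice, so that the total jump is 0. *)
rewrite leq_eqVlt ltnNge ltn_ord orbF => /eqP kE.
rewrite big_pred0 /= -?kE ?modnn //.
rewrite (eq_bigl predT) => [|r]; last by rewrite ltn_ord.
rewrite (big_chords B) big1 // => d _; rewrite chord_of_partner endpointK.
exact: addrr_F2.
Qed.

(** By [potential_step] the left side compares the arc after [B k] with the arc [k], as gluing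
    requires. The two copies of [t] cancel, and the term [x (chord_of B k)] cancels the diagonal
    correction in [alternate_parity]. *)
Lemma potential_partner t x k :
  potential t x (B k) + x (chord_of B k) + potential t x k =
  \sum_d x d * (alternate (chord_of B k) d)%:R.
Proof.
rewrite !ffunE !sum_before.
have -> : x (chord_of B k) = \sum_d x d * (d == chord_of B k)%:R.
  rewrite (bigD1 (chord_of B k)) //= eqxx mulr1 big1 ?addr0 // => d.
  by move/negPf->; rewrite mulr0.
set S1 := \sum_d _; set S2 := \sum_d _; set S3 := \sum_d _.
have -> : t + S1 + S2 + (t + S3) = (t + t) + (S3 + S1 + S2) by ring.
rewrite addrr_F2 add0r -!big_split; apply: eq_bigr => d _ /=.
rewrite -!mulrDr -!natrD natr_F2 oddD alternate_parity.
by rewrite oddb -addbA addbb addbF.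
Qed.

(** At a point of a chord of [U], invariance is the kernel equation of that chord; at any other
    point it says that the jump is 0, which is assumed. *)
Lemma potential_invariant U t x :
  (forall c, c \notin U -> x c = 0) ->
  [forall k, potential t x (face_step U k) == potential t x k] =
  [forall c in U, \sum_d x d * (alternate c d)%:R == 0].
Proof.
move=> x0; apply/forallP/forall_inP => [inv c cU|ker k].
  have := inv (endpoint c); rewrite face_stepE /partner_in endpointK cU.
  rewrite potential_step chord_of_partner addr_eq_F2 potential_partner.
  by rewrite endpointK.
rewrite face_stepE potential_step /partner_in.
have [kU|kU] := boolP (chord_of B k \in U); last by rewrite x0 ?addr0.
by rewrite chord_of_partner addr_eq_F2 potential_partner ker.
Qed.

Lemma invariant_potential U (f : {ffun point -> 'F_2}) (z : point) :
  z = 0%N :> nat -> [forall k, f (face_step U k) == f k] ->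
  exists2 x : {ffun chord B -> 'F_2},
    forall c, c \notin U -> x c = 0 & f = potential (f z) x.
Proof.
move=> z0 /forallP inv.
pose x : {ffun chord B -> 'F_2} :=
  [ffun c : chord B => f (ordS (endpoint c)) + f (endpoint c)].
have step k : f (ordS k) = f k + x (chord_of B k).
  have fS l : f (ordS l) = f l + (f (ordS l) + f l).
    by rewrite addrCA addrr_F2 addr0.
  rewrite ffunE; case: (endpoint_chord_of B k) => ->; first exact: fS.
  rewrite {1}fS; congr (_ + _).
  (* The jumps at the two endpoints must agree. Off [U] both vanish. On [U] invariance gives
     [f (ordS k) = f (B k)] and [f (ordS (B k)) = f k], so both jumps equal [f k + f (B k)]. *)
  have [kU|kU] := boolP (chord_of B k \in U); last first.
    have := inv k; have := inv (B k); rewrite !face_stepE /partner_in.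
    by rewrite chord_of_partner (negPf kU) => /eqP -> /eqP ->; rewrite !addrr_F2.
  have := inv k; have := inv (B k); rewrite !face_stepE /partner_in.
  rewrite chord_of_partner kU (cd_involutive B).
  by move=> /eqP -> /eqP ->; rewrite addrC.
exists x => [c cU|].
  rewrite ffunE; have := inv (endpoint c); rewrite face_stepE /partner_in.
  by rewrite endpointK (negPf cU) => /eqP ->; rewrite addrr_F2.
apply/ffunP=> -[k km]; elim: k => [|k IHk] in km *.
  have -> : Ordinal km = z by apply: val_inj; rewrite [RHS]z0.
  by rewrite ffunE big_pred0 ?addr0 // => r; rewrite z0.
have kE : Ordinal km = ordS (Ordinal (ltnW km)).
  by apply: val_inj; rewrite /= modn_small.
by rewrite kE step potential_step IHk.
Qed.

Lemma potential_inj (z : point) t t' x x' :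
  z = 0%N :> nat -> (potential t x = potential t' x') -> t = t' /\ x = x'.
Proof.
move=> z0 e; have pz s y : potential s y z = s.
  by rewrite ffunE big_pred0 ?addr0 // => r; rewrite z0.
split; first by rewrite -(pz t x) e pz.
apply/ffunP=> c; rewrite -[c]endpointK.
apply: (addrI (potential t x (endpoint c))).
by rewrite -potential_step e potential_step.
Qed.

(** The free value on the arc 0 accounts for the successor in the exponent. *)
Lemma card_face_F2 U : (0 < n)%N ->
  #|[set f : {ffun point -> 'F_2} | [forall k, f (face_step U k) == f k]]| =
  (2 ^ (corank (@adjmx (intersection_graph B) U)).+1)%N.
Proof.
move=> n0; have n20 : (0 < n.*2)%N by rewrite double_gt0.
pose z : point := Ordinal n20; have z0 : z = 0%N :> nat by [].
rewrite expnS -card_adj_kernel; set K := (X in (2 * #|pred_of_set X|)%N).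
pose pot (p : 'F_2 * {ffun chord B -> 'F_2}) := potential p.1 p.2.
transitivity #|pot @: setX [set: 'F_2] K|; last first.
  rewrite card_imset ?cardsX ?cardsT ?card_Fp // => -[t x] [t' x'].
  by case/(potential_inj z0) => /= -> ->.
apply: eq_card => f; rewrite inE; apply/idP/imsetP => [inv|[[t x]]].
  have [x x0 fx] := invariant_potential z0 inv; exists (f z, x) => //.
  move: inv; rewrite fx potential_invariant // => /forall_inP ker.
  rewrite !inE; apply/forallP => c; case: ifP => [|/negbT/x0->//]; exact: ker.
rewrite !inE /= => /forallP Kx ->; rewrite potential_invariant => [|c cU].
  by apply/forall_inP => c cU; have := Kx c; rewrite cU.
by have := Kx c; rewrite (negPf cU) => /eqP.
Qed.

(* The number of faces does not depend on the set of colours, so that it can be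
   read off the case of two colours. *)
Lemma card_face (A : finType) U : (0 < n)%N ->
  #|[set f : {ffun point -> A} | [forall k, f (face_step U k) == f k]]| =
  (#|A| ^ (corank (@adjmx (intersection_graph B) U)).+1)%N.
Proof.
move=> n0; rewrite card_invariant_ffun; congr (_ ^ _)%N.
by have := card_face_F2 U n0; rewrite card_invariant_ffun card_Fp // => /eqP;
   rewrite eqn_exp2l // => /eqP.
Qed.
End FaceCount.

(** * The trace of the representation on a chord diagram *)

Lemma sum_delta (R : nzRingType) (T : finType) (a : T) (F : T -> R) :
  \sum_x (x == a)%:R * F x = F a.
Proof.
rewrite (bigD1 a) //= eqxx mul1r big1 ?addr0 // => x /negPf->.
by rewrite mul0r.
Qed.

Section Representation.
Variables (R : comNzRingType) (eps : R).

Definition shifted_E N (i j : 'I_N) : 'M[R]_N :=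
  delta_mx i j + (eps *+ (i == j))%:M.

Lemma shifted_E_entry N (i j a b : 'I_N) :
  shifted_E i j a b = (i == a)%:R * (j == b)%:R + eps * (i == j)%:R * (a == b)%:R.
Proof.
rewrite !mxE ![_ == i]eq_sym ![_ == j]eq_sym -mulr_natr.
by do 4!case: eqP => _; rewrite /= ?(mulr1n, mulr0n, mulr1, mulr0).
Qed.

(** The product of the two matrix units gives the glued ribbon. The two mixed terms give [eps] each,
    and the product of the two scalar parts gives [eps ^+ 2] once for every colour [a = b]. *)
Lemma chord_contribution N (p p' q q' : 'I_N) :
  \sum_a \sum_b shifted_E a b p p' * shifted_E b a q q' =
  (q' == p)%:R * (p' == q)%:R
  + (2 * eps + N%:R * eps ^+ 2) * ((p' == p)%:R * (q' == q)%:R).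
Proof.
have idem (b : bool) : b%:R * b%:R = b%:R :> R by case: b; rewrite ?mulr1 ?mulr0.
(* Each term leads with a delta in [b], and the first three continue with a delta in [a], ready for
   [sum_delta]. The last one keeps a free sum over [a], the source of the factor [N%:R]. *)
have E a b : shifted_E a b p p' * shifted_E b a q q' =
    (b == p')%:R * ((a == p)%:R * ((b == q)%:R * (a == q')%:R))
    + (b == p')%:R * ((a == p)%:R * (eps * (a == b)%:R * (q' == q)%:R))
    + (b == q)%:R * ((a == q')%:R * (eps * (a == b)%:R * (p' == p)%:R))
    + (b == a)%:R * (eps ^+ 2 * (p' == p)%:R * (q' == q)%:R).
  rewrite !shifted_E_entry [b == a]eq_sym [p' == p]eq_sym [q' == q]eq_sym.
  have := idem (a == b); move: (_ == b)%:R => x xx; ring: xx.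
under eq_bigr => a _.
  under eq_bigr => b _ do rewrite E.
  rewrite !big_split /= !sum_delta.
  over.
rewrite !big_split /= !sum_delta sumr_const card_ord -mulr_natr.
rewrite [p == q']eq_sym [p == p']eq_sym; ring.
Qed.

Section Trace.
Variables (N n : nat) (B : chord_diagram n).
Local Notation point := 'I_(n.*2).
Local Notation v := (2 * eps + N.+1%:R * eps ^+ 2).

(** Invariance under [face_step U] is a product of local conditions at the points; grouped by
    chords, these are the glued or the absent pattern according to membership in [U]. *)
Lemma prod_face (A : finType) (f : {ffun point -> A}) (U : {set chord B}) :
  \prod_(c : chord B)
     (if c \in U then (f (ordS (B (endpoint c))) == f (endpoint c))%:R
                      * (f (ordS (endpoint c)) == f (B (endpoint c)))%:R
      else v * ((f (ordS (endpoint c)) == f (endpoint c))%:R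
                * (f (ordS (B (endpoint c))) == f (B (endpoint c)))%:R)) =
  v ^+ (#|{: chord B}| - #|U|) * [forall k, f (face_step U k) == f k]%:R.
Proof.
have -> : [forall k, f (face_step U k) == f k]%:R =
          \prod_k (f (face_step U k) == f k)%:R :> R.
  case: forallP => [inv|/forallP/forallPn[k /negPf kU]].
    by rewrite big1 // => k _; rewrite inv.
  by rewrite (bigD1 k) //= kU mul0r.
rewrite (big_chords B) /= -[U in (_ - #|pred_of_set U|)%N]setCK -cardsCs.
rewrite -prodr_const.
have -> : \prod_(c in ~: U) v = \prod_c (if c \in U then 1 else v).
  by rewrite big_mkcond; apply: eq_bigr => c _; rewrite inE; case: (c \in U).
rewrite -big_split; apply: eq_bigr => c _ /=.
rewrite !face_stepE /partner_in chord_of_partner endpointK.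
by case: ifP => _; rewrite ?mul1r ?cd_involutive.
Qed.

Lemma trace_chord_diagram : (0 < n)%N ->
  \tr (\sum_(i : {ffun point -> 'I_N.+1}) \prod_k shifted_E (i k) (i (B k))) =
  \sum_(U : {set chord B}) v ^+ (#|{: chord B}| - #|U|)
     * N.+1%:R ^+ (corank (@adjmx (intersection_graph B) U)).+1.
Proof.
move=> n0; rewrite raddf_sum /=.
under eq_bigr => i _ do rewrite mxtrace_prod_gt0 ?double_gt0 //.
rewrite exchange_big /=.
under eq_bigr => f _.
  under eq_bigr => i _ do rewrite (big_chords B) /=.
  under eq_bigr => i _ do under eq_bigr => c _ do rewrite cd_involutive.
  rewrite (big_ffun_chords (fun c a b =>
     shifted_E a b (f (endpoint c)) (f (ordS (endpoint c))) *
     shifted_E b a (f (B (endpoint c))) (f (ordS (B (endpoint c)))))).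
  under eq_bigr => c _ do rewrite chord_contribution.
  (* Expanding the product of two-term factors: [U] collects the chords at which the ribbon term is
     taken. *)
  rewrite bigA_distr /=.
  under eq_bigr => U _ do rewrite prod_face.
  over.
rewrite exchange_big; apply: eq_bigr => U _ /=.
rewrite -mulr_sumr; congr (_ * _); rewrite -natrX -[in RHS](card_ord N.+1).
rewrite -card_face // -sum1_card natr_sum [RHS]big_mkcond /=.
by apply: eq_bigr => f _; rewrite inE; case: ifP.
Qed.
End Trace.
End Representation.

(** Scalar shifts do not affect commutators, and on the right side the two scalar parts, both
    present exactly when [i = l] and [j = k], cancel. *)
Lemma shifted_E_comm (R : comNzRingType) (eps : R) N (i j k l : 'I_N.+1) :
  shifted_E eps i j * shifted_E eps k l - shifted_E eps k l * shifted_E eps i j =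
  shifted_E eps i l *+ (j == k) - shifted_E eps k j *+ (l == i).
Proof.
have scC c (X : 'M[R]_N.+1) : c%:M * X = X * c%:M by apply/esym/scalar_mxC.
have lft (X Y : 'M[R]_N.+1) c : (X + c%:M) * Y - Y * (X + c%:M) = X * Y - Y * X.
  by rewrite mulrDl mulrDr scC opprD addrACA subrr addr0.
have rgt (X Y : 'M[R]_N.+1) c : X * (Y + c%:M) - (Y + c%:M) * X = X * Y - Y * X.
  by rewrite mulrDl mulrDr scC opprD addrACA subrr addr0.
rewrite /shifted_E lft rgt ![delta_mx _ _ * _]mul_delta_mx_cond.
rewrite [i == l]eq_sym [k == j]eq_sym; case: eqP => _; case: eqP => _;
  rewrite /= !(mulr1n, mulr0n, addr0, subr0, sub0r, raddf0) //.
by rewrite opprD addrACA subrr addr0.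
Qed.

(** * The representation of U gl(N) *)

Section UglRepresentation.
Variables (K : fieldType) (N : nat).
Local Notation S := 'M[{poly K}]_N.+1.

(** The variable ['X] of [{poly K}] plays the role of eps. *)
Definition word_eval (m : {fmonom ('I_N.+1 * 'I_N.+1)%type}) : S :=
  \prod_(p <- m) shifted_E 'X p.1 p.2.

Fact word_eval_mmorphism : mmorphism word_eval.
Proof.
split=> [m m'|]; rewrite /word_eval; first by rewrite fmM big_cat.
by rewrite fm1 big_nil.
Qed.
HB.instance Definition _ := isMultiplicative.Build _ _ word_eval
  word_eval_mmorphism.

Definition scalar_rep : K -> S := scalar_mx \o polyC.
HB.instance Definition _ := GRing.RMorphism.copy scalar_rep (scalar_mx \o polyC).

Definition free_rep (x : free_gl K N.+1) : S := mmap scalar_rep word_eval x.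

Fact free_rep_zmod_morphism : zmod_morphism free_rep.
Proof. exact: mmap_is_additive. Qed.
HB.instance Definition _ := GRing.isZmodMorphism.Build _ _ free_rep
  free_rep_zmod_morphism.

Fact free_rep_monoid_morphism : monoid_morphism free_rep.
Proof.
have [M1 M2] : multiplicative free_rep.
  by apply: commr_mmap_is_multiplicative => g m m'; apply/esym/scalar_mxC.
by [].
Qed.
HB.instance Definition _ := GRing.isMonoidMorphism.Build _ _ free_rep
  free_rep_monoid_morphism.

Lemma free_rep_E i j : free_rep (free_E K i j) = shifted_E 'X i j.
Proof.
by rewrite /free_rep mmapU /= rmorph1 mul1r /word_eval fmU big_seq1.
Qed.

Lemma free_repZ c x : free_rep (c *: x) = scalar_rep c * free_rep x.
Proof. exact: mmapZ. Qed.

Lemma free_rep_ideal x : gl_ideal x -> free_rep x = 0.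
Proof.
elim=> {x} [i j k l||x y _ x0 _ y0|a x _ x0|a x _ x0].
- rewrite /gl_rel.
  (* Generalizing keeps unification from unfolding the monoid algebra. *)
  move: (free_E K i j) (free_E K k l) (free_E K i l) (free_E K k j)
    (free_rep_E i j) (free_rep_E k l) (free_rep_E i l) (free_rep_E k j).
  move=> a b c d ha hb hc hd.
  have := free_rep_monoid_morphism.2 a b; have := free_rep_monoid_morphism.2 b a.
  move: (a * b) (b * a) => ab ba hba hab.
  rewrite 3!(raddfB free_rep) 2!(raddfMn free_rep) /= hab hba ha hb hc hd.
  by rewrite -shifted_E_comm subrr.
- exact: rmorph0.
- by rewrite rmorphD /= x0 y0 addr0.
- by rewrite free_rep_monoid_morphism.2 x0 mulr0.
- by rewrite free_rep_monoid_morphism.2 x0 mul0r.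
Qed.

(** Evaluated at a chosen representative; [Ugl_rep_pi] shows that the choice does not matter. *)
Definition Ugl_rep (x : Ugl K N.+1) : S := free_rep (generic_quotient.repr x).

Lemma Ugl_rep_pi x : Ugl_rep (Ugl_pi x) = free_rep x.
Proof.
have /eqP := free_rep_ideal (repr_pi x).
by rewrite raddfB subr_eq0 => /eqP.
Qed.

Fact Ugl_rep_zmod_morphism : zmod_morphism Ugl_rep.
Proof.
move=> x y; rewrite -(Ugl_reprK x) -(Ugl_reprK y).
move: (generic_quotient.repr x) (generic_quotient.repr y) => a b.
have -> : Ugl_pi a - Ugl_pi b = Ugl_pi (a - b).
  by apply/eqP; rewrite subr_eq -Ugl_piD subrK.
by rewrite !Ugl_rep_pi rmorphB.
Qed.
HB.instance Definition _ := GRing.isZmodMorphism.Build _ _ Ugl_rep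
  Ugl_rep_zmod_morphism.

Fact Ugl_rep_monoid_morphism : monoid_morphism Ugl_rep.
Proof.
split; first by rewrite [1]/(Ugl_pi 1) Ugl_rep_pi rmorph1.
move=> x y; rewrite -(Ugl_reprK x) -(Ugl_reprK y).
move: (generic_quotient.repr x) (generic_quotient.repr y) => a b.
by rewrite [_ * _]Ugl_mulE !Ugl_rep_pi free_rep_monoid_morphism.2.
Qed.
HB.instance Definition _ := GRing.isMonoidMorphism.Build _ _ Ugl_rep
  Ugl_rep_monoid_morphism.

Lemma Ugl_rep_in_alg c : Ugl_rep c%:A = scalar_rep c.
Proof.
by rewrite [c%:A]Ugl_scaleE Ugl_rep_pi free_repZ rmorph1 mulr1.
Qed.

Lemma Ugl_rep_E i j : Ugl_rep (Ugl_E K i j) = shifted_E 'X i j.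
Proof. by rewrite Ugl_rep_pi free_rep_E. Qed.

Lemma Ugl_rep_w m (alpha : 'S_m) :
  Ugl_rep (w_glN K N.+1 alpha) =
  \sum_(i : {ffun 'I_m -> 'I_N.+1}) \prod_k shifted_E 'X (i k) (i (alpha k)).
Proof.
rewrite rmorph_sum; apply: eq_bigr => i _; rewrite rmorph_prod.
by apply: eq_bigr => k _; apply: Ugl_rep_E.
Qed.

(* A Casimir element is a trace, over the noncommutative ring of matrices, of a
   power of [block_E]. *)
Definition block_E : 'M[S]_N.+1 := \matrix_(i, j) shifted_E 'X i j.
Definition block_delta : 'M[S]_N.+1 := \matrix_(i, j) delta_mx i j.
Definition block_scalar : {poly K} -> 'M[S]_N.+1 := scalar_mx \o scalar_mx.
HB.instance Definition _ := GRing.RMorphism.copy block_scalar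
  (scalar_mx \o scalar_mx).

Lemma block_scalar_entry c X i j : (block_scalar c * X) i j = c *: X i j.
Proof.
by rewrite [block_scalar c * X](mul_scalar_mx c%:M X) mxE [LHS]mul_scalar_mx.
Qed.

Lemma block_EE : block_E = block_delta + block_scalar 'X.
Proof.
apply/matrixP=> i j; rewrite !mxE /shifted_E; congr (_ + _).
by case: eqP => _; rewrite ?mulr1n ?mulr0n ?raddf0.
Qed.

Lemma block_delta_sqr :
  block_delta * block_delta = block_scalar N.+1%:R * block_delta.
Proof.
apply/matrixP=> i j; rewrite block_scalar_entry !mxE.
under eq_bigr => l _ do rewrite !mxE [_ * _]mul_delta_mx.
by rewrite sumr_const card_ord scaler_nat.
Qed.

(** Centrality holds although the entries do not commute, because the diagonal entries are
    themselves scalar matrices. *)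
Lemma block_scalarC c X : block_scalar c * X = X * block_scalar c.
Proof.
apply/matrixP=> i j; rewrite block_scalar_entry [RHS]mxE (bigD1 j) //= big1.
  rewrite addr0 [block_scalar c j j]mxE eqxx mulr1n -[LHS]mul_scalar_mx.
  exact/esym/scalar_mxC.
by move=> l /negPf lj; rewrite !mxE lj mulr0n mulr0.
Qed.

(** The binomial expansion of a power of [block_delta + block_scalar 'X] collapses by
    [block_delta_sqr]. The factor [N.+1%:R] on the left avoids a division. *)
Lemma block_E_exp k :
  block_scalar N.+1%:R * block_E ^+ k =
  block_scalar ('X ^+ k * N.+1%:R)
  + block_scalar ((N.+1%:R + 'X) ^+ k - 'X ^+ k) * block_delta.
Proof.
elim: k => [|k IHk].
  by rewrite !expr0 subrr rmorph0 mul0r addr0 mul1r mulr1.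
rewrite exprSr mulrA IHk block_EE mulrDl !mulrDr -!mulrA block_delta_sqr.
rewrite -[block_delta * block_scalar _]block_scalarC !mulrA -!rmorphM.
rewrite [X in X + _]addrC -!addrA -!mulrDl -!rmorphD.
by congr (block_scalar _ + block_scalar _ * _); rewrite !exprS; ring.
Qed.

Lemma mxtrace_block_delta : \tr block_delta = 1.
Proof.
rewrite /mxtrace; under eq_bigr => i _ do rewrite mxE.
by rewrite -mx1_sum_delta.
Qed.

Lemma mxtrace_block_scalar c X : \tr (block_scalar c * X) = c *: \tr X.
Proof.
by rewrite scaler_sumr; apply: eq_bigr => i _; rewrite block_scalar_entry.
Qed.

Lemma Ugl_rep_casimir k :
  N.+1%:R *: Ugl_rep (casimir K N.+1 k.+1) =
  ((N.+1%:R + 'X) ^+ k.+1 - (1 - N.+1%:R ^+ 2) * 'X ^+ k.+1)%:M.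
Proof.
have -> : Ugl_rep (casimir K N.+1 k.+1) = \tr (block_E ^+ k.+1).
  rewrite -[k.+1 in RHS]card_ord -prodr_const mxtrace_prod Ugl_rep_w.
  by apply: eq_bigr => i _; apply: eq_bigr => l _; rewrite permE mxE.
(* The scalar part has trace [N.+1] times itself, which produces [N.+1%:R ^+ 2]; the trace of
   [block_delta] is the identity. *)
rewrite -mxtrace_block_scalar block_E_exp mxtraceD mxtrace_block_scalar.
rewrite mxtrace_block_delta scalemx1 [X in X + _]mxtrace_scalar -raddfMn -raddfD.
congr (_%:M); rewrite -mulr_natr; ring.
Qed.

(** * Evaluation of [F_eps] at positive integers *)

Section Evaluation.
Hypothesis charK : [pchar K] =i pred0.

Lemma natrS_neq0 : N.+1%:R != 0 :> {poly K}.
Proof. by rewrite -polyC_natr polyC_eq0; move/pcharf0P: charK => ->. Qed.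

Lemma Ugl_rep_casimir_value k :
  Ugl_rep (casimir K N.+1 k.+1) = ((casimir_value K k.+1).[N.+1%:R])%:M.
Proof.
have := casimir_valueE K k.+1.
move/(congr1 (fun p => p.[N.+1%:R])); rewrite /varN /vareps !hornerE /= => E.
have := Ugl_rep_casimir k; rewrite -E => /matrixP e.
apply/matrixP=> i j; have := e i j; rewrite !mxE -mulrnAr.
by move/(mulfI natrS_neq0).
Qed.

(** As a ring morphism, [Ugl_rep] carries the substitution of Casimir elements into [P] to the
    substitution of their scalars. *)
Lemma F_eps_eval m (alpha : 'S_m) (P : casimir_poly K) : is_w_gl alpha P ->
  ((F_eps P).[N.+1%:R])%:M =
  \sum_(i : {ffun 'I_m -> 'I_N.+1}) \prod_k shifted_E 'X (i k) (i (alpha k)).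
Proof.
move=> /(_ N.+1 isT) wP; rewrite -Ugl_rep_w -wP /F_eps /casimir_subst !mmapE.
rewrite rmorph_sum horner_sum raddf_sum; apply: eq_bigr => c _ /=.
rewrite hornerM hornerC horner_prod [in RHS]rmorphM /= Ugl_rep_in_alg.
rewrite [in LHS]rmorphM rmorph_prod rmorph_prod; congr (_ * _).
(* Index 0 is the variable N; the positive indices are the Casimir variables. *)
apply: eq_bigr => -[|k] _; rewrite horner_exp !rmorphXn /=.
  by rewrite /varN hornerX !rmorph_nat.
by rewrite -Ugl_rep_casimir_value.
Qed.
End Evaluation.
End UglRepresentation.

(** * Interpolation in N *)

Lemma poly_eq_at_naturals (R : idomainType) (p q : {poly R}) :
  [pchar R] =i pred0 -> (forall N, p.[N.+1%:R] = q.[N.+1%:R]) -> p = q.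
Proof.
move=> charR pq; apply/eqP; rewrite -subr_eq0; apply/eqP.
(* As many roots as the size of [p - q], pairwise distinct in characteristic 0. *)
pose rs : seq R := [seq i.+1%:R | i <- iota 0 (size (p - q))].
apply: (@roots_geq_poly_eq0 _ _ rs).
- apply/allP=> _ /mapP[N _ ->].
  by rewrite rootE hornerD hornerN pq subrr.
- rewrite map_inj_uniq ?iota_uniq // => i j ij.
  wlog le_ij : i j ij / (i <= j)%N.
    by case: (leqP i j) => [|/ltnW] ? H; [|apply/esym]; apply: H.
  have /eqP : (j.+1 - i.+1)%:R = 0 :> R by rewrite natrB // ij subrr.
  rewrite (pcharf0P R).1 // subSS subn_eq0 => le_ji.
  by apply/eqP; rewrite eqn_leq le_ij.
by rewrite size_map size_iota.
Qed.

Section Interpolation.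
Variables (K : fieldType) (n : nat) (B : chord_diagram n) (P : casimir_poly K).
Hypothesis charK : [pchar K] =i pred0.
Hypothesis wP : is_w_gl (cd_perm B) P.
Local Notation Q := (refined_skew_char (intersection_graph B)).

Lemma refined_skew_char_eval N :
  (Q (varv K) (varN K)).[N.+1%:R] =
  \sum_(U : {set chord B})
     (2 * 'X + N.+1%:R * 'X ^+ 2) ^+ (#|{: chord B}| - #|U|)
     * N.+1%:R ^+ corank (@adjmx (intersection_graph B) U).
Proof.
rewrite horner_sum; apply: eq_bigr => U _.
by rewrite hornerM !horner_exp /varN hornerX /varv /varN /vareps !hornerE.
Qed.

Lemma F_eps_chord_diagram_eval N :
  (F_eps P).[N.+1%:R] = (Q (varv K) (varN K)).[N.+1%:R].
Proof.
have F_eval := F_eps_eval N charK wP; rewrite refined_skew_char_eval.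
(* Without chords there are no arcs to colour: the single empty product acts as the identity, and
   only [U = set0] occurs on the other side. *)
have [n0|n_gt0] := posnP n.
  have no_point (k : 'I_(n.*2)) : False.
    by have := leq_ltn_trans (leq0n k) (ltn_ord k); rewrite double_gt0 n0.
  have no_chord (c : chord B) : False by apply: (no_point (endpoint c)).
  have : ((F_eps P).[N.+1%:R])%:M = 1 :> 'M_N.+1.
    rewrite F_eval (eq_bigr (fun=> 1)) => [|i _].
      by rewrite sumr_const card_ffun !card_ord n0 expn0.
    by rewrite big1 // => k; case: (no_point k).
  move/(congr1 mxtrace).
  rewrite mxtrace1 mxtrace_scalar => F1.
  transitivity (1 : {poly K}).
    by apply: (mulIf (natrS_neq0 N charK)); rewrite mul1r mulr_natr.
  rewrite (bigD1 set0) //= big1 => [|U /set0Pn[c]]; last by case: (no_chord c).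
  have /eqP -> : corank (@adjmx (intersection_graph B) set0) == 0%N.
    by rewrite -leqn0 (leq_trans (leq_subr _ _)) // cards0.
  by rewrite eq_card0 ?mulr1 ?addr0 // => c; case: (no_chord c).
(* Taking the trace of a scalar matrix multiplies by the dimension, which absorbs the extra 1 in the
   exponent of [trace_chord_diagram]. *)
apply: (mulfI (natrS_neq0 N charK)).
rewrite [LHS]mulr_natl -mxtrace_scalar F_eval.
rewrite trace_chord_diagram // mulr_sumr; apply: eq_bigr => U _.
by rewrite [X in _ * X]exprS mulrCA.
Qed.

Lemma F_eps_chord_diagram : F_eps P = Q (varv K) (varN K).
Proof.
apply: poly_eq_at_naturals F_eps_chord_diagram_eval.
by move=> p; rewrite pchar_poly.
Qed.

(** Before the substitution the outer variable is u and the inner one w. The map [map_poly polyC]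
    sends w to the outer variable N, so the coefficients of the powers of [varv] are free of eps. *)
Lemma refined_skew_char_varv (G : sgraph) :
  refined_skew_char G (varv K) (varN K) =
  (map_poly (map_poly polyC) (refined_skew_char G 'X ('X%:P))).[varv K].
Proof.
rewrite /refined_skew_char rmorph_sum horner_sum; apply: eq_bigr => U _ /=.
rewrite rmorphM !rmorphXn /= map_polyX map_polyC /= map_polyX.
by rewrite hornerM !horner_exp hornerX hornerC.
Qed.
End Interpolation.

Theorem mainTheorem4 (R : realType) (n : nat) (B : chord_diagram n)
    (w_gl : casimir_poly R[i]) (w_glP : is_w_gl (cd_perm B) w_gl) :
  F_eps w_gl =
    refined_skew_char (intersection_graph B) (varv R[i]) (varN R[i]) /\
  (exists q : {poly {poly R[i]}},
     F_eps w_gl = (map_poly (map_poly polyC) q).[varv R[i]]).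
Proof.
have FQ := F_eps_chord_diagram (@Num.Theory.pchar_num _) w_glP.
by split=> //; rewrite FQ; eexists; apply: refined_skew_char_varv.
Qed.
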